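(* Let $M^3$ be a Lagrangian submanifold of the homogeneous nearly Kähler sphere $\mathbb S^6(1)$, and let $S=(S_{ij})$ be the symmetric nonnegative definite matrix $S_{ij}=\sum_{a,b}h_{abi}h_{abj}$ built from the components $h_{ijk}$ of its second fundamental form at a point. Diagonalize $S$ at the point, say $S_{ij}=\mu_i\delta_{ij}$, and write $s=\sum_i\mu_i$, $q=\sum_i\mu_i^2$, $r=\sum_i\mu_i^3$. If $0\le\mu_i\le\tfrac{15}{8}$ for $i=1,2,3$ and $s^3+3sq-10r\ge0$, then $F(s,q,r)\ge0$, where $$F(s,q,r)=-\tfrac{11}{36}s^3+\tfrac{55}{36}sq-3r+\tfrac5{24}s^2+\tfrac{25}{24}q+\tfrac{25r}{16s}\quad\text{for } s>0,$$ and $F=0$ when $s=0$.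
   Context: $\mathbb S^6(1)$ is the unit sphere in the imaginary Cayley numbers $\mathbb R^7$ with its standard metric $\langle\cdot,\cdot\rangle$ and the almost complex structure $J_xX=x\times X$ given by the Cayley cross product. A three-dimensional submanifold $M^3$ is Lagrangian if $J(TM)=T^\perp M$; such a submanifold is automatically minimal. With $h$ the second fundamental form and $\{e_1,e_2,e_3\}$ a local oriented orthonormal tangent frame, $h_{ijk}=\langle h(e_i,e_j),Je_k\rangle$; these components are totally symmetric in $i,j,k$ and trace-free, i.e. $\sum_i h_{iik}=0$ for all $k$. The quantities $s,q,r$ equal $\operatorname{tr}S=|h|^2$, $\operatorname{tr}(S^2)$, $\operatorname{tr}(S^3)$, respectively. *)

(* Defs.v *)
From HB Require Import structures.
From mathcomp Require Import all_boot all_order all_algebra.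
From mathcomp Require Import ring.
From mathcomp Require Import all_classical all_reals all_analysis.

Set Implicit Arguments.
Unset Strict Implicit.
Unset Printing Implicit Defensive.

Import Order.TTheory GRing.Theory Num.Theory.
Import numFieldNormedType.Exports.

Local Open Scope classical_set_scope.
Local Open Scope ring_scope.

Section Cayley.
Variable R : realType.
Implicit Types u v : 'rV[R]_7.

Definition dot u v : R := \sum_(k < 7) u 0 k * v 0 k.

(* Cross product of imaginary Cayley numbers, Im (u v), for the basis with
   e_k e_(k+1) = e_(k+3); indices are added in 'I_7, i.e., modulo 7. *)
Definition cross u v : 'rV[R]_7 :=
  \row_(k < 7) (u 0 (k + 1) * v 0 (k + 3) - u 0 (k + 3) * v 0 (k + 1)
              + u 0 (k + 2) * v 0 (k + 6) - u 0 (k + 6) * v 0 (k + 2)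
              + u 0 (k + 4) * v 0 (k + 5) - u 0 (k + 5) * v 0 (k + 4)).

(* The next two identities characterize the Cayley cross product up to an
   isometry of R^7. *)
Let coord7 u : exists a : nat -> R, forall k : 'I_7, u 0 k = a (k : nat).
Proof. by exists (fun n => u 0 (inord n)) => k; rewrite inord_val. Qed.

Lemma dot_crossl u v : dot (cross u v) u = 0.
Proof.
have [a ua] := coord7 u; have [b vb] := coord7 v.
rewrite /dot !big_ord_recl big_ord0 !mxE !ua !vb.
cbn; ring.
Qed.

Lemma dot_cross u v :
  dot (cross u v) (cross u v) = dot u u * dot v v - dot u v ^+ 2.
Proof.
have [a ua] := coord7 u; have [b vb] := coord7 v.
rewrite /dot !big_ord_recl !big_ord0 !mxE !ua !vb.
cbn; ring.
Qed.

Definition unit_sphere : set 'rV[R]_7 := [set y | dot y y = 1].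

Definition acs (y X : 'rV[R]_7) : 'rV[R]_7 := cross y X.

End Cayley.

Section Submanifold.
Variable R : realType.

Definition iter_derive (m n : nat) (f : 'rV[R]_m.+1 -> 'rV[R]_n.+1)
    (s : seq 'rV[R]_m.+1) : 'rV[R]_m.+1 -> 'rV[R]_n.+1 :=
  foldr (fun v g => fun u => 'D_v g u) f s.

(* C^infinity on the open set U: all iterated directional derivatives exist
   and are continuous. *)
Definition smooth_on (m n : nat) (U : set 'rV[R]_m.+1)
    (f : 'rV[R]_m.+1 -> 'rV[R]_n.+1) : Prop :=
  forall (s : seq 'rV[R]_m.+1) (u : 'rV[R]_m.+1), U u ->
    {for u, continuous (iter_derive f s)} /\
    forall v, derivable (iter_derive f s) u v.

Variables (M : topologicalType) (x : M -> 'rV[R]_7).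

(* phi restricted to U is a homeomorphism onto an open subset of M which
   x immerses smoothly.  The transition maps between two such
   parametrizations are then automatically smooth diffeomorphisms. *)
Definition local_param (U : set 'rV[R]_3) (phi : 'rV[R]_3 -> M) : Prop :=
  [/\ open U,
      set_inj U phi,
      forall u, U u -> {for u, continuous phi},
      forall V, open V -> V `<=` U -> open (phi @` V) &
      smooth_on U (x \o phi) /\
      forall u a, U u -> 'D_a (x \o phi) u = 0 -> a = 0].

Definition immersed_submanifold3 : Prop :=
  [/\ hausdorff_space M, @second_countable M &
      forall p : M, exists U phi u, [/\ local_param U phi, U u & phi u = p]].

(* Flat derivative of Y at p along the tangent vector X; tangent vectors of M
   are identified with their images in R^7 under the differential of x.  The
   set is a singleton when X is tangent at p and Y is smooth near p. *)
Definition ddir (Y : M -> 'rV[R]_7) (p : M) (X : 'rV[R]_7) : 'rV[R]_7 :=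
  xget 0 [set Z | exists U phi u a,
    [/\ local_param U phi, U u, phi u = p,
        'D_a (x \o phi) u = X & 'D_a (Y \o phi) u = Z]].

Definition tangent (p : M) : set 'rV[R]_7 :=
  [set X | exists U phi u a,
    [/\ local_param U phi, U u, phi u = p & 'D_a (x \o phi) u = X]].

(* Normal space of M at p inside the tangent space of the sphere at x p. *)
Definition normal (p : M) : set 'rV[R]_7 :=
  [set xi | dot xi (x p) = 0 /\ forall X, tangent p X -> dot xi X = 0].

Definition lagrangian_S6 : Prop :=
  [/\ immersed_submanifold3,
      forall p, unit_sphere (x p) &
      forall p, [set acs (x p) X | X in tangent p] = normal p].

(* Levi-Civita connection of the sphere: tangential part of the flat
   derivative. *)
Definition nablaS (p : M) (X : 'rV[R]_7) (Y : M -> 'rV[R]_7) : 'rV[R]_7 :=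
  ddir Y p X - dot (ddir Y p X) (x p) *: x p.

(* Gauss formula: h(X, Y) is the normal component of nablaS_X Y. *)
Definition sff (p : M) (X : 'rV[R]_7) (Y : M -> 'rV[R]_7) : 'rV[R]_7 :=
  xget 0 [set xi | normal p xi /\ tangent p (nablaS p X Y - xi)].

Definition orthonormal_frame (W : set M) (e : 'I_3 -> M -> 'rV[R]_7) : Prop :=
  [/\ forall i y, W y -> tangent y (e i y),
      forall i j y, W y -> dot (e i y) (e j y) = (i == j)%:R &
      forall i U phi, local_param U phi -> phi @` U `<=` W ->
        smooth_on U (e i \o phi)].

Definition hcomp (p : M) (e : 'I_3 -> M -> 'rV[R]_7) (i j k : 'I_3) : R :=
  dot (sff p (e i p) (e j)) (acs (x p) (e k p)).

Definition Smx (p : M) (e : 'I_3 -> M -> 'rV[R]_7) : 'M[R]_3 :=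
  \matrix_(i, j) \sum_(a < 3) \sum_(b < 3) hcomp p e a b i * hcomp p e a b j.

End Submanifold.

Definition Ffun (R : realType) (s q r : R) : R :=
  if 0 < s then
    - (11 / 36) * s ^+ 3 + 55 / 36 * (s * q) - 3 * r
    + 5 / 24 * s ^+ 2 + 25 / 24 * q + (25 * r) / (16 * s)
  else 0.

(* Main.v *)
Require Import Defs.
From HB Require Import structures.
From mathcomp Require Import all_boot all_order all_algebra.
From mathcomp Require Import ring lra.
From mathcomp Require Import all_classical all_reals all_analysis.

Import Order.TTheory GRing.Theory Num.Theory.
Import numFieldNormedType.Exports.

Local Open Scope classical_set_scope.
Local Open Scope ring_scope.

(** The inequality is a property of the three numbers mu_i alone.  Write
    F = P2 - P3 with P2, P3 homogeneous of degrees 2 and 3.  Since P2 >= 0, the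
    worst scaling of the mu_i is the one in which the largest of them, a, equals
    15/8, so it suffices to show H := a s P2 - (15/8) s P3 >= 0, a homogeneous
    quartic.  With u = b + c and v = b c for the other two numbers, both H and
    the constraint s^3 + 3 s q - 10 r >= 0 are affine in v, and the constraint
    forces u >= 2 a / 3.  According to the sign of the coefficient of v in H, one
    replaces v by its upper bound u^2 / 4 or its lower bound a (u - a); the two
    resulting quartics in u factor over [2 a / 3, 2 a].  Equality holds at
    (a, a, a) and (a, a/3, a/3). *)

Section ThreeNumbers.
Variable R : realFieldType.
Implicit Types a u v : R.

(** With s, q, r written in a, u, v, the last hypothesis is one sixth of s^3 + 3 s q - 10 r. *)
Lemma constraint_sum_ge a u v : 0 < a -> 0 <= u -> 0 <= v -> 4 * v <= u ^+ 2 ->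
  0 <= v * (4 * u - a) - (a - u) ^+ 2 * (a + u) -> 2 * a <= 3 * u.
Proof.
move=> a0 u0 v0 vu G0; rewrite leNgt; apply/negP => ua.
have [ua4|ua4] := leP (4 * u) a.
  have : 0 < (a - u) ^+ 2 * (a + u) by rewrite mulr_gt0 ?exprn_gt0; lra.
  have : 0 <= v * (a - 4 * u) by rewrite mulr_ge0; lra.
  lra.
(* At v = u^2 / 4 the constraint reads a (3 u - 2 a) (2 a + u) / 4 >= 0. *)
have : 0 < a * ((2 * a - 3 * u) * (2 * a + u)) by rewrite !mulr_gt0; lra.
have : 0 <= (u ^+ 2 - 4 * v) * (4 * u - a) by rewrite mulr_ge0; lra.
lra.
Qed.

Lemma quartic_ge0 a u v : 0 < a -> 2 * a <= 3 * u -> u <= 2 * a ->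
  4 * v <= u ^+ 2 -> a * (u - a) <= v ->
  0 <= - 5 * a ^+ 4 - 5 * a ^+ 3 * u + 38 * a ^+ 2 * u ^+ 2 + 6 * a * u ^+ 3
       - 32 * u ^+ 4 + v * (107 * u ^+ 2 - 13 * a * u - 75 * a ^+ 2).
Proof.
move=> a0 ua au vu uv.
have au0 : 0 <= a * u by rewrite mulr_ge0; lra.
have [B0|B0] := leP (107 * u ^+ 2 - 13 * a * u - 75 * a ^+ 2) 0.
  have : 0 <= (u ^+ 2 - 4 * v) *
              - (107 * u ^+ 2 - 13 * a * u - 75 * a ^+ 2).
    by rewrite mulr_ge0; lra.
  (* This is four times the quartic at v = u^2 / 4. *)
  have : 0 <= (3 * u - 2 * a) * (2 * a - u) *
              (7 * u ^+ 2 + 15 * (a * u) + 5 * a ^+ 2).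
    have := sqr_ge0 a; have := sqr_ge0 u => u20 a20.
    by rewrite !mulr_ge0; lra.
  lra.
have : 0 <= (v - a * (u - a)) * (107 * u ^+ 2 - 13 * a * u - 75 * a ^+ 2).
  by rewrite mulr_ge0; lra.
(* 7/6 is close to the minimum of 35 - 16 t - 49 t^2 + 32 t^3 over t >= 0. *)
have : 0 <= (2 * a - u) * ((u - 7 / 6 * a) ^+ 2 * (32 * u + 77 / 3 * a)
                           + a ^+ 2 * (u / 3 + 7 / 108 * a)).
  apply: mulr_ge0; first lra.
  by apply: addr_ge0; rewrite mulr_ge0 ?sqr_ge0 //; lra.
lra.
Qed.

End ThreeNumbers.

Lemma Ffun_max_ge0 (R : realType) (a b c s q r : R) :
  a <= 15 / 8 -> 0 <= b <= a -> 0 <= c <= a ->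
  s = a + b + c -> q = a ^+ 2 + b ^+ 2 + c ^+ 2 ->
  r = a ^+ 3 + b ^+ 3 + c ^+ 3 ->
  0 <= s ^+ 3 + 3 * s * q - 10 * r -> 0 <= Ffun s q r.
Proof.
move=> a15 /andP[b0 ba] /andP[c0 ca] sE qE rE G0; rewrite /Ffun.
case: ifP => // s0.
have a0 : 0 < a by lra.
have bc0 : 0 <= b * c by rewrite mulr_ge0.
have bc4 : 4 * (b * c) <= (b + c) ^+ 2 by have := sqr_ge0 (b - c); lra.
have bca : a * (b + c - a) <= b * c.
  have : 0 <= (a - b) * (a - c) by rewrite mulr_ge0; lra.
  lra.
have u0 : 2 * a <= 3 * (b + c).
  apply: (@constraint_sum_ge _ _ _ (b * c)) => //; first lra.
  by move: G0; rewrite sE qE rE; lra.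
have au : b + c <= 2 * a by lra.
have := @quartic_ge0 _ _ _ _ a0 u0 au bc4 bca.
set H := (X in 0 <= X) => H0.
have q0 : 0 <= q by rewrite qE !addr_ge0 ?sqr_ge0.
have r0 : 0 <= r by rewrite rE !addr_ge0 ?exprn_ge0 //; lra.
pose P := 5 / 24 * s ^+ 3 + 25 / 24 * (s * q) + 25 / 16 * r.
have P0 : 0 <= P.
  by rewrite !addr_ge0 ?mulr_ge0 ?exprn_ge0 //; lra.
have aP0 : 0 <= (15 / 8 - a) * P by rewrite mulr_ge0; lra.
set F := (X in 0 <= X).
(* [P] is s P2, and 5/48 [H] is a s P2 - (15/8) s P3. *)
have sF : 15 / 8 * (s * F) = 5 / 48 * H + (15 / 8 - a) * P.
  have -> : s * F = P - s * (11 / 36 * s ^+ 3 - 55 / 36 * (s * q) + 3 * r).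
    by rewrite /F /P; field; rewrite gt_eqF.
  by rewrite /P /H sE qE rE; field.
by rewrite -(pmulr_rge0 F s0); lra.
Qed.

Theorem lemma4p2 (R : realType) (M : topologicalType) (x : M -> 'rV[R]_7)
    (hM : lagrangian_S6 x) (p : M) (W : set M) (hWo : open W) (hWp : W p)
    (e : 'I_3 -> M -> 'rV[R]_7) (he : orthonormal_frame x W e)
    (mu : 'I_3 -> R)
    (hmu : forall i j : 'I_3, Smx x p e i j = mu i * (i == j)%:R)
    (s q r : R)
    (hs : s = \sum_(i < 3) mu i)
    (hq : q = \sum_(i < 3) mu i ^+ 2)
    (hr : r = \sum_(i < 3) mu i ^+ 3)
    (hbound : forall i : 'I_3, 0 <= mu i <= 15 / 8)
    (hsqr : 0 <= s ^+ 3 + 3 * s * q - 10 * r) :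
  0 <= Ffun s q r.
Proof.
move: hs hq hr; rewrite !big_ord_recl !big_ord0 !addr0.
move: (hbound ord0) (hbound (lift ord0 ord0))
  (hbound (lift ord0 (lift ord0 ord0))).
move: (mu _) (mu _) (mu _) => c b a /andP[a0 a15] /andP[b0 b15] /andP[c0 c15].
move=> sE qE rE.
(* By symmetry, the largest number is passed first. *)
have [ba|ab] := leP b a; have [ca|ac] := leP c a; have [cb|bc] := leP c b.
all: first [ apply: (@Ffun_max_ge0 _ a b c) => //; lra
           | apply: (@Ffun_max_ge0 _ b a c) => //; lra
           | apply: (@Ffun_max_ge0 _ c a b) => //; lra ].
Qed.
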